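(* Let $k$ be a field, let $A$ be a $k$-algebra, and let $p(x)=x^2-\alpha x+\beta\in k[x]$ with $\alpha,\beta\in k$. The set of twisting maps $\tau: k[x]/(p(x))\otimes A\longrightarrow A\otimes k[x]/(p(x))$ is in one-to-one correspondence with the set of pairs $(f,\delta)$, where $f:A\to A$ is an endomorphism of algebras and $\delta:A\to A$ is a left $f$-derivation, satisfying $$\delta^2-\alpha\delta+\beta\,\mathrm{id}_A=\beta f^2 \qquad\text{and}\qquad f\delta+\delta f=\alpha(f-f^2).$$ The correspondence is given by $\tau(x\otimes a)=\delta(a)\otimes 1+f(a)\otimes x$ for all $a\in A$.
   Context: All algebras are unital associative $k$-algebras, algebra morphisms are unital, all maps are $k$-linear, and $\otimes=\otimes_k$. For algebras $A,B$ with products $\mu_A,\mu_B$ (and writing $A$, $B$ also for the identity maps), a (unital) twisting map is a $k$-linear map $\tau:B\otimes A\to A\otimes B$ such that $\tau\circ(B\otimes\mu_A)=(\mu_A\otimes B)\circ(A\otimes\tau)\circ(\tau\otimes A)$, $\tau\circ(\mu_B\otimes A)=(A\otimes\mu_B)\circ(\tau\otimes B)\circ(B\otimes\tau)$, and $\tau(1\otimes a)=a\otimes 1$, $\tau(b\otimes 1)=1\otimes b$ for all $a\in A$, $b\in B$. A left $f$-derivation is a $k$-linear map $\delta:A\to A$ with $\delta(ab)=\delta(a)b+f(a)\delta(b)$ for all $a,b\in A$. Here $x$ denotes also the class of $x$ in $k[x]/(p(x))$. *)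

(* Defs.v *)
From HB Require Import structures.
From mathcomp Require Import all_boot all_order all_algebra.
From mathcomp Require Import boolp classical_sets functions.

Set Implicit Arguments.
Unset Strict Implicit.
Unset Printing Implicit Defensive.

Import GRing.Theory.
Local Open Scope ring_scope.

(* Unital associative algebras. The library's algType excludes the zero       *)
(* algebra, which is allowed here; its hierarchy has no join of pzRingType    *)
(* and lmodType on which to build, hence the separate names of the operations.*)
HB.mixin Record Lmodule_isUnitalAlgebra (k : fieldType) A
    of GRing.Lmodule k A := {
  amul : A -> A -> A;
  aone : A;
  amul_bilinear : bilinear_for ( *:%R : k -> A -> A) ( *:%R : k -> A -> A) amul;
  amulA : associative amul;
  amul1l : left_id aone amul;
  amul1r : right_id aone amul
}.

#[short(type="unitalAlgType")]
HB.structure Definition UnitalAlgebra (k : fieldType) :=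
  {A of GRing.Lmodule k A & Lmodule_isUnitalAlgebra k A}.

HB.instance Definition _ (k : fieldType) (A : unitalAlgType k) :=
  bilinear_isBilinear.Build k A A A *:%R *:%R (@amul k A) amul_bilinear.

Fact mulr_bilinear (k : fieldType) (A : algType k) :
  bilinear_for ( *:%R : k -> A -> A) ( *:%R : k -> A -> A) *%R.
Proof.
split=> [b|a] c u v /=; first by rewrite mulrDl scalerAl.
by rewrite mulrDr scalerAr.
Qed.

HB.instance Definition _ (k : fieldType) (A : algType k) :=
  Lmodule_isUnitalAlgebra.Build k A
    (@mulr_bilinear k A) (@mulrA A) (@mul1r A) (@mulr1 A).

HB.instance Definition _ (k : fieldType) (p : {poly k}) :=
  Lmodule_isUnitalAlgebra.Build k {poly %/ p}
    (@mulr_bilinear k {poly %/ p}) (@mulrA _) (@mul1r _) (@mulr1 _).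

Lemma linear_ext (k : pzRingType) (U V : lmodType k) (f g : {linear U -> V}) :
  f =1 g -> f = g.
Proof.
case: f g => [f [[f1] [f2]]] [g [[g1] [g2]]] /= /funext fg.
case: _ / fg in g1 g2 *.
by rewrite (Prop_irrelevance f1 g1) (Prop_irrelevance f2 g2).
Qed.

(* The tensor product over k: elements are classes of finite formal sums of   *)
(* pure tensors, for the congruence generated by commutativity of the sum and *)
(* bilinearity.                                                               *)
Section TensorProduct.
Variables (k : fieldType) (U V : lmodType k).

Inductive tens_rel : seq (U * V) -> seq (U * V) -> Prop :=
| tens_refl s : tens_rel s s
| tens_sym s t : tens_rel s t -> tens_rel t s
| tens_trans s t r : tens_rel s t -> tens_rel t r -> tens_rel s r
| tens_cat s s' t t' :
    tens_rel s s' -> tens_rel t t' -> tens_rel (s ++ t) (s' ++ t')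
| tens_swap s t : tens_rel (s ++ t) (t ++ s)
| tens_zero v : tens_rel [:: (0, v)] [::]
| tens_addl u u' v : tens_rel [:: (u + u', v)] [:: (u, v); (u', v)]
| tens_addr u v v' : tens_rel [:: (u, v + v')] [:: (u, v); (u, v')]
| tens_scale c u v : tens_rel [:: (c *: u, v)] [:: (u, c *: v)].

Definition tens_relb : rel (seq (U * V)) := fun s t => `[< tens_rel s t >].

Lemma tens_relbP s t : reflect (tens_rel s t) (tens_relb s t).
Proof. exact: asboolP. Qed.

Lemma tens_relb_refl : reflexive tens_relb.
Proof. by move=> s; apply/tens_relbP/tens_refl. Qed.

Lemma tens_relb_sym : symmetric tens_relb.
Proof.
by move=> s t; apply/tens_relbP/tens_relbP => /tens_sym.
Qed.

Lemma tens_relb_trans : transitive tens_relb.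
Proof.
by move=> t s r /tens_relbP st /tens_relbP tr; apply/tens_relbP/(tens_trans st).
Qed.

Canonical tens_equiv :=
  EquivRel tens_relb tens_relb_refl tens_relb_sym tens_relb_trans.

Definition tensor := {eq_quot tens_equiv}%qT.
HB.instance Definition _ := Choice.on tensor.
HB.instance Definition _ := EqQuotient.on tensor.

Definition tens_class (s : seq (U * V)) : tensor := (\pi_tensor s)%qT.
Definition tens (u : U) (v : V) : tensor := tens_class [:: (u, v)].

Lemma tens_classP s t : tens_rel s t <-> tens_class s = tens_class t.
Proof.
split=> [st|]; first by apply/eqP; rewrite /tens_class piE; apply/tens_relbP.
by move=> /eqP; rewrite /tens_class piE => /tens_relbP.
Qed.

Lemma tens_class_repr x : tens_class (repr x) = x.
Proof. exact: reprK. Qed.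

Lemma repr_tens_class s : tens_rel (repr (tens_class s)) s.
Proof. by apply/tens_classP; rewrite tens_class_repr. Qed.

Definition tens0 : tensor := tens_class [::].
Definition tensD (x y : tensor) : tensor := tens_class (repr x ++ repr y).
Definition tensZ (c : k) (x : tensor) : tensor :=
  tens_class [seq (c *: p.1, p.2) | p <- repr x].

Lemma tens_rel_map (c : k) s t : tens_rel s t ->
  tens_rel [seq (c *: p.1, p.2) | p <- s] [seq (c *: p.1, p.2) | p <- t].
Proof.
elim=> {s t} /=.
- by move=> s; apply: tens_refl.
- by move=> s t _ /tens_sym.
- by move=> s t r _ st _ /(tens_trans st).
- by move=> s s' t t' _ ss' _ tt'; rewrite !map_cat; apply: tens_cat.
- by move=> s t; rewrite !map_cat; apply: tens_swap.
- by move=> v; rewrite scaler0; apply: tens_zero.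
- by move=> u u' v; rewrite scalerDr; apply: tens_addl.
- by move=> u v v'; apply: tens_addr.
- move=> d u v; rewrite scalerA mulrC -scalerA; exact: tens_scale.
Qed.

Lemma tensDE s t : tensD (tens_class s) (tens_class t) = tens_class (s ++ t).
Proof. by apply/tens_classP/tens_cat; apply: repr_tens_class. Qed.

Lemma tensZE c s :
  tensZ c (tens_class s) = tens_class [seq (c *: p.1, p.2) | p <- s].
Proof. by apply/tens_classP/tens_rel_map/repr_tens_class. Qed.

Lemma tens_classW (P : tensor -> Prop) :
  (forall s, P (tens_class s)) -> forall x, P x.
Proof. by move=> Ps x; rewrite -(tens_class_repr x). Qed.

Lemma tensDA : associative tensD.
Proof.
elim/tens_classW=> s; elim/tens_classW=> t; elim/tens_classW=> r.
by rewrite !tensDE catA.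
Qed.

Lemma tensDC : commutative tensD.
Proof.
elim/tens_classW=> s; elim/tens_classW=> t.
by rewrite !tensDE; apply/tens_classP/tens_swap.
Qed.

Lemma tens0D : left_id tens0 tensD.
Proof. by elim/tens_classW=> s; rewrite /tens0 tensDE. Qed.

Lemma tensZDl (x : tensor) (c d : k) :
  tensZ (c + d) x = tensD (tensZ c x) (tensZ d x).
Proof.
elim/tens_classW: x => s; rewrite !tensZE tensDE; apply/tens_classP.
elim: s => [|[u v] s IHs] /=; first exact: tens_refl.
set t1 := [seq (c *: _, _) | _ <- s] in IHs *.
set t2 := [seq (d *: _, _) | _ <- s] in IHs *.
apply: (@tens_trans _ (([:: (c *: u, v)] ++ [:: (d *: u, v)]) ++ (t1 ++ t2))).
  apply: (@tens_cat [:: _]); last exact: IHs.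
  by rewrite scalerDl; apply: tens_addl.
rewrite -catA; apply: (@tens_cat [:: _] [:: _]); first exact: tens_refl.
apply: (@tens_trans _ ((t1 ++ [:: (d *: u, v)]) ++ t2)).
  by rewrite catA; apply: tens_cat; [apply: tens_swap | apply: tens_refl].
by rewrite -catA; apply: tens_refl.
Qed.

Lemma tens0Z (x : tensor) : tensZ 0 x = tens0.
Proof.
elim/tens_classW: x => s; rewrite tensZE; apply/tens_classP.
elim: s => [|[u v] s IHs] /=; first exact: tens_refl.
rewrite -cat1s scale0r.
exact: (tens_trans (tens_cat (tens_zero v) IHs) (tens_refl _)).
Qed.

Lemma tens1Z (x : tensor) : tensZ 1 x = x.
Proof.
elim/tens_classW: x => s; rewrite tensZE; congr tens_class.
by elim: s => [|[u v] s /= ->] //; rewrite scale1r.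
Qed.

Lemma tensND : left_inverse tens0 (tensZ (- 1)) tensD.
Proof. by move=> x; rewrite -{2}(tens1Z x) -tensZDl addNr tens0Z. Qed.

HB.instance Definition _ :=
  GRing.isZmodule.Build tensor tensDA tensDC tens0D tensND.

Lemma tensZA (c d : k) (x : tensor) : tensZ c (tensZ d x) = tensZ (c * d) x.
Proof.
elim/tens_classW: x => s; rewrite !tensZE -map_comp; congr tens_class.
by apply: eq_map => -[u v] /=; rewrite scalerA.
Qed.

Lemma tensZDr : right_distributive tensZ +%R.
Proof.
move=> c; elim/tens_classW=> s; elim/tens_classW=> t.
by rewrite [X in tensZ c X]tensDE tensZE map_cat -tensDE -!tensZE.
Qed.

HB.instance Definition _ := GRing.Zmodule_isLmodule.Build k tensor
  tensZA tens1Z tensZDr tensZDl.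

Lemma tens_classD s t : tens_class (s ++ t) = tens_class s + tens_class t.
Proof. by rewrite -tensDE. Qed.

Lemma tens_classZ (c : k) s :
  tens_class [seq (c *: p.1, p.2) | p <- s] = c *: tens_class s.
Proof. by rewrite -tensZE. Qed.

Fact tens_is_bilinear :
  bilinear_for ( *:%R : k -> tensor -> tensor)
    ( *:%R : k -> tensor -> tensor) tens.
Proof.
split=> [v c u u'|u c v v'] /=.
  rewrite /tens -tens_classZ -tens_classD.
  exact/tens_classP/tens_addl.
rewrite /tens -tens_classZ -tens_classD; apply/tens_classP.
apply: (tens_trans (tens_addr _ _ _)).
apply: (@tens_cat [:: _] [:: _]); last exact: tens_refl.
exact/tens_sym/tens_scale.
Qed.

HB.instance Definition _ :=
  bilinear_isBilinear.Build k U V tensor *:%R *:%R tens tens_is_bilinear.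

Lemma tens_classE s : tens_class s = \sum_(p <- s) tens p.1 p.2.
Proof.
elim: s => [|[u v] s IHs]; first by rewrite big_nil.
by rewrite big_cons -IHs -tens_classD.
Qed.

Lemma tens_ind (P : tensor -> Prop) :
  P 0 -> (forall x y, P x -> P y -> P (x + y)) ->
  (forall u v, P (tens u v)) -> forall x, P x.
Proof.
move=> P0 PD Pt; elim/tens_classW=> s; rewrite tens_classE.
by elim/big_ind: _.
Qed.

Lemma linear_tens_ext (W : lmodType k) (f g : {linear tensor -> W}) :
  (forall u v, f (tens u v) = g (tens u v)) -> f =1 g.
Proof.
move=> fg; elim/tens_ind => [|x y fgx fgy|u v]; last exact: fg.
  by rewrite !linear0.
by rewrite !linearD fgx fgy.
Qed.

Section Lift.
Variables (W : lmodType k) (b : {bilinear U -> V -> W}).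

Definition tens_lift_fun (x : tensor) : W := \sum_(p <- repr x) b p.1 p.2.

Lemma tens_rel_lift s t : tens_rel s t ->
  \sum_(p <- s) b p.1 p.2 = \sum_(p <- t) b p.1 p.2.
Proof.
elim=> {s t}.
- by [].
- by move=> s t _ ->.
- by move=> s t r _ -> _ ->.
- by move=> s s' t t' _ E1 _ E2; rewrite !big_cat /= E1 E2.
- by move=> s t; rewrite !big_cat /= addrC.
- by move=> v; rewrite big_seq1 big_nil /= linear0l.
- by move=> u u' v; rewrite !big_cons !big_nil /= !addr0 linearDl.
- by move=> u v v'; rewrite !big_cons !big_nil /= !addr0 linearDr.
- by move=> c u v; rewrite !big_seq1 /= linearZl_LR linearZr_LR.
Qed.

Lemma tens_lift_class s :
  tens_lift_fun (tens_class s) = \sum_(p <- s) b p.1 p.2.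
Proof. exact/tens_rel_lift/repr_tens_class. Qed.

Lemma tens_lift_fun_linear : linear tens_lift_fun.
Proof.
move=> c; elim/tens_classW=> s; elim/tens_classW=> t.
rewrite -tens_classZ -tens_classD !tens_lift_class.
rewrite big_cat big_map /= scaler_sumr; congr (_ + _).
by apply: eq_bigr => p _; rewrite linearZl_LR.
Qed.

HB.instance Definition _ :=
  GRing.isLinear.Build k tensor W *:%R tens_lift_fun tens_lift_fun_linear.

Definition tens_lift : {linear tensor -> W} := tens_lift_fun.

Lemma tens_liftE u v : tens_lift (tens u v) = b u v.
Proof. by rewrite /= tens_lift_class big_seq1. Qed.

End Lift.
End TensorProduct.

Arguments tens {k U V} u v.
Arguments tens_lift {k U V W} b.

Notation "U ⊗ V" := (tensor U V)
  (at level 40, left associativity).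
Notation "u \ot v" := (tens u v)
  (at level 40, left associativity) : ring_scope.

Section TensorMap.
Variables (k : fieldType) (U U' V V' : lmodType k).
Variables (f : {linear U -> U'}) (g : {linear V -> V'}).

Definition tens_map_fun (u : U) (v : V) : (U' ⊗ V') := f u \ot g v.

Fact tens_map_bilinear : bilinear_for
  ( *:%R : k -> U' ⊗ V' -> U' ⊗ V') ( *:%R : k -> U' ⊗ V' -> U' ⊗ V')
  tens_map_fun.
Proof.
split=> [v|u] c x y; rewrite /= /tens_map_fun linearP.
  by rewrite linearPl.
by rewrite linearPr.
Qed.

HB.instance Definition _ := bilinear_isBilinear.Build k U V (U' ⊗ V')
  *:%R *:%R tens_map_fun tens_map_bilinear.

Definition tens_map : {linear U ⊗ V -> U' ⊗ V'} := tens_lift tens_map_fun.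

Lemma tens_mapE u v : tens_map (u \ot v) = f u \ot g v.
Proof. exact: tens_liftE. Qed.

End TensorMap.

Section TensorAssoc.
Variables (k : fieldType) (U V W : lmodType k).

Section Slices.
Variables (u : U) (w : W).

Definition tens_assoc_slice (x : U) (y : V) : (U ⊗ (V ⊗ W)) :=
  x \ot (y \ot w).

Fact tens_assoc_slice_bilinear : bilinear_for
  ( *:%R : k -> U ⊗ (V ⊗ W) -> U ⊗ (V ⊗ W))
  ( *:%R : k -> U ⊗ (V ⊗ W) -> U ⊗ (V ⊗ W)) tens_assoc_slice.
Proof.
split=> [v|u'] c x y; rewrite /= /tens_assoc_slice; first by rewrite linearPl.
by rewrite linearPl linearPr.
Qed.

HB.instance Definition _ := bilinear_isBilinear.Build k U V
  (U ⊗ (V ⊗ W)) *:%R *:%R tens_assoc_slice tens_assoc_slice_bilinear.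

Definition tens_assocV_slice (y : V) (z : W) : (U ⊗ V ⊗ W) :=
  (u \ot y) \ot z.

Fact tens_assocV_slice_bilinear : bilinear_for
  ( *:%R : k -> U ⊗ V ⊗ W -> U ⊗ V ⊗ W)
  ( *:%R : k -> U ⊗ V ⊗ W -> U ⊗ V ⊗ W) tens_assocV_slice.
Proof.
split=> [w'|v] c x y; rewrite /= /tens_assocV_slice.
  by rewrite linearPr linearPl.
by rewrite linearPr.
Qed.

HB.instance Definition _ := bilinear_isBilinear.Build k V W
  (U ⊗ V ⊗ W) *:%R *:%R tens_assocV_slice tens_assocV_slice_bilinear.

End Slices.

Definition tens_assoc_fun (x : (U ⊗ V)) (w : W) : (U ⊗ (V ⊗ W)) :=
  tens_lift (tens_assoc_slice w) x.

Fact tens_assoc_bilinear : bilinear_for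
  ( *:%R : k -> U ⊗ (V ⊗ W) -> U ⊗ (V ⊗ W))
  ( *:%R : k -> U ⊗ (V ⊗ W) -> U ⊗ (V ⊗ W)) tens_assoc_fun.
Proof.
split=> [w|x] c y z; rewrite /tens_assoc_fun; first exact: linearP.
elim/tens_ind: x => [|x1 x2 IH1 IH2|u v].
- by rewrite !linear0 /= scaler0 addr0.
- by rewrite !linearD IH1 IH2 /= scalerDr addrACA.
- by rewrite !tens_liftE /= /tens_assoc_slice !linearPr.
Qed.

HB.instance Definition _ := bilinear_isBilinear.Build k (U ⊗ V) W
  (U ⊗ (V ⊗ W)) *:%R *:%R tens_assoc_fun tens_assoc_bilinear.

Definition tens_assoc : {linear U ⊗ V ⊗ W -> U ⊗ (V ⊗ W)} :=
  tens_lift tens_assoc_fun.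

Lemma tens_assocE u v w : tens_assoc (u \ot v \ot w) = u \ot (v \ot w).
Proof. by rewrite tens_liftE; exact: tens_liftE. Qed.

Definition tens_assocV_fun (u : U) (y : (V ⊗ W)) : (U ⊗ V ⊗ W) :=
  tens_lift (tens_assocV_slice u) y.

Fact tens_assocV_bilinear : bilinear_for
  ( *:%R : k -> U ⊗ V ⊗ W -> U ⊗ V ⊗ W)
  ( *:%R : k -> U ⊗ V ⊗ W -> U ⊗ V ⊗ W) tens_assocV_fun.
Proof.
split=> [y|u] c x z; rewrite /tens_assocV_fun; last exact: linearP.
elim/tens_ind: y => [|y1 y2 IH1 IH2|v w].
- by rewrite !linear0 /= scaler0 addr0.
- by rewrite !linearD IH1 IH2 /= scalerDr addrACA.
- by rewrite !tens_liftE /= /tens_assocV_slice !linearPl.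
Qed.

HB.instance Definition _ := bilinear_isBilinear.Build k U (V ⊗ W)
  (U ⊗ V ⊗ W) *:%R *:%R tens_assocV_fun tens_assocV_bilinear.

Definition tens_assocV : {linear U ⊗ (V ⊗ W) -> U ⊗ V ⊗ W} :=
  tens_lift tens_assocV_fun.

Lemma tens_assocVE u v w : tens_assocV (u \ot (v \ot w)) = u \ot v \ot w.
Proof. by rewrite tens_liftE; exact: tens_liftE. Qed.

End TensorAssoc.

Arguments tens_assoc {k} U V W.
Arguments tens_assocV {k} U V W.

Notation "f \ox g" := (tens_map f g)
  (at level 40, left associativity) : ring_scope.

Definition tens_mul (k : fieldType) (A : unitalAlgType k) :
  {linear A ⊗ A -> A} := tens_lift (@amul k A).

Lemma tens_mulE (k : fieldType) (A : unitalAlgType k) (a b : A) :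
  tens_mul A (a \ot b) = amul a b.
Proof. exact: tens_liftE. Qed.

Section Twisting.
Variables (k : fieldType) (A B : unitalAlgType k).

Local Notation idA := (idfun : {linear A -> A}).
Local Notation idB := (idfun : {linear B -> B}).
Local Notation mu := tens_mul.

Record twisting_map (tau : {linear B ⊗ A -> A ⊗ B}) : Prop := TwistingMap {
  twisting_mulA :
    tau \o (idB \ox mu A) =1
    (mu A \ox idB) \o tens_assocV A A B \o (idA \ox tau) \o
      tens_assoc A B A \o (tau \ox idA) \o tens_assocV B A A;
  twisting_mulB :
    tau \o (mu B \ox idA) =1
    (idA \ox mu B) \o tens_assoc A B B \o (tau \ox idB) \o
      tens_assocV B A B \o (idB \ox tau) \o tens_assoc B B A;
  twisting_1A : forall a : A, tau (aone \ot a) = a \ot aone;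
  twisting_1B : forall b : B, tau (b \ot aone) = aone \ot b
}.

End Twisting.

Section Derivation.
Variables (k : fieldType) (A : unitalAlgType k).

Definition alg_endomorphism (f : {linear A -> A}) : Prop :=
  f aone = aone /\ forall a b : A, f (amul a b) = amul (f a) (f b).

Definition left_derivation (f delta : {linear A -> A}) : Prop :=
  forall a b : A,
    delta (amul a b) = amul (delta a) b + amul (f a) (delta b).

End Derivation.

Definition quad_poly (k : fieldType) (alpha beta : k) : {poly k} :=
  'X^2 - alpha *: 'X + beta%:P.

(* {poly %/ p} is k[X]/(p) only when mk_monic p = p.                          *)
Lemma mk_monic_quad_poly (k : fieldType) (alpha beta : k) :
  mk_monic (quad_poly alpha beta) = quad_poly alpha beta.
Proof.
have szr : (size (- (alpha *: 'X) + beta%:P : {poly k})%R < 3)%N.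
  rewrite (leq_ltn_trans (size_polyD _ _)) // gtn_max size_polyN.
  rewrite (leq_ltn_trans (size_scale_leq _ _)) ?size_polyX //=.
  by rewrite (leq_ltn_trans (size_polyC_leq1 _)).
have sz : size (quad_poly alpha beta) = 3.
  by rewrite /quad_poly -addrA size_polyDl size_polyXn.
rewrite /mk_monic sz /= monicE /quad_poly -addrA lead_coefDl ?size_polyXn //.
by rewrite lead_coefXn eqxx.
Qed.

(* Main.v *)
Require Import Defs.
From HB Require Import structures.
From mathcomp Require Import all_boot all_order all_algebra.
From mathcomp Require Import boolp classical_sets functions.

Set Implicit Arguments.
Unset Strict Implicit.
Unset Printing Implicit Defensive.

Import GRing.Theory.
Local Open Scope ring_scope.
Local Open Scope classical_set_scope.

(** Put B = k[x]/(x^2 - alpha x + beta). As 1 and x form a basis of B, every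
    element of A ⊗ B is u ⊗ 1 + v ⊗ x for unique u and v in A
    ([tens_sliceE], [tens_basis_inj]). Hence a linear tau : B ⊗ A -> A ⊗ B with
    tau(1 ⊗ a) = a ⊗ 1 amounts to two linear maps delta and f on A, read off
    from tau(x ⊗ a) = delta(a) ⊗ 1 + f(a) ⊗ x, and any two linear maps occur
    ([basis_lift]).

    It remains to see what the axioms of a twisting map say about (f, delta).
    By linearity in B they need only be tested on the basis, and where a factor
    from B is 1 they hold automatically. The other cases give, by comparing
    coordinates:
    - multiplicativity in A at x ⊗ a ⊗ a':
      delta(aa') = delta(a)a' + f(a)delta(a') and f(aa') = f(a)f(a');
    - multiplicativity in B at x ⊗ x ⊗ a: since x^2 = alpha x - beta, one side
      is (alpha delta(a) - beta a) ⊗ 1 + alpha f(a) ⊗ x, while applying tau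
      twice gives
      (delta^2(a) - beta f^2(a)) ⊗ 1
        + (f delta(a) + delta f(a) + alpha f^2(a)) ⊗ x;
    - the unit of A: f(1) = 1 and delta(1) = 0, the latter being a consequence
      of the derivation rule.
    These are the conditions on the pair; the equivalence is [twisting_mapP],
    stated for any algebra with a basis 1, x such that
    x^2 = alpha x - beta. *)

(** * Coordinates on a tensor product *)

Section Slice.
Variables (k : fieldType) (U V : lmodType k) (c : {scalar V}).

Definition slice_fun (u : U) (v : V) : U := c v *: u.

Fact slice_bilinear :
  bilinear_for ( *:%R : k -> U -> U) ( *:%R : k -> U -> U) slice_fun.
Proof.
split=> [v|u] d y z; rewrite /slice_fun /=.
  by rewrite scalerDr !scalerA mulrC.
by rewrite linearP /= scalerDl scalerA.
Qed.

HB.instance Definition _ :=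
  bilinear_isBilinear.Build k U V U *:%R *:%R slice_fun slice_bilinear.

Definition slice : {linear U ⊗ V -> U} := tens_lift slice_fun.

Lemma sliceE u v : slice (u \ot v) = c v *: u.
Proof. exact: tens_liftE. Qed.

End Slice.

Arguments slice {k U V} c.

(* Lets the compositions defining [twist_pair] be recognized as linear. *)
HB.instance Definition _ (k : fieldType) (U V : lmodType k) (u : U) :=
  GRing.isLinear.Build k V (U ⊗ V) *:%R (@tens k U V u) (linearPr tens u).

(** * Twisting maps over an algebra with basis 1, x *)

Section QuadraticBasis.
Variables (k : fieldType) (B : unitalAlgType k) (x : B) (alpha beta : k).
(* The basis of [B] dual to 1, x. *)
Variables c0 c1 : {scalar B}.
Hypothesis basisE : forall b, b = c0 b *: aone + c1 b *: x.
Hypotheses (c0_1 : c0 aone = 1) (c1_1 : c1 aone = 0).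
Hypotheses (c0_x : c0 x = 0) (c1_x : c1 x = 1).
Hypothesis sqrxE : amul x x = alpha *: x - beta *: aone.

Lemma linear_basis_tens_ext (U W : lmodType k) (g h : {linear B ⊗ U -> W}) :
  (forall u, g (aone \ot u) = h (aone \ot u)) ->
  (forall u, g (x \ot u) = h (x \ot u)) -> g =1 h.
Proof.
move=> gh1 ghx; apply: linear_tens_ext => b u.
by rewrite [b]basisE linearPl linearZl_LR !linearD !linearZ /= gh1 ghx.
Qed.

Lemma basis_tens3r_ext (U V W : lmodType k)
    (g h : {linear B ⊗ (U ⊗ V) -> W}) :
  (forall u v, g (aone \ot (u \ot v)) = h (aone \ot (u \ot v))) ->
  (forall u v, g (x \ot (u \ot v)) = h (x \ot (u \ot v))) -> g =1 h.
Proof.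
have ext b : (forall u v, g (b \ot (u \ot v)) = h (b \ot (u \ot v))) ->
    forall z, g (b \ot z) = h (b \ot z).
  move=> ghb; elim/tens_ind=> [|y z ghy ghz|u v]; last exact: ghb.
    by rewrite linear0r !linear0.
  by rewrite linearDr !linearD ghy ghz.
by move=> gh1 ghx; apply: linear_basis_tens_ext; apply: ext.
Qed.

(** In the first two hypotheses [b] is arbitrary because the two unit cases of
    multiplicativity in [B] hold for every [b]; only the test at [x \ot x] then
    has content. *)
Lemma basis_tens3_ext (U W : lmodType k) (g h : {linear B ⊗ B ⊗ U -> W}) :
  (forall b u, g (aone \ot b \ot u) = h (aone \ot b \ot u)) ->
  (forall b u, g (b \ot aone \ot u) = h (b \ot aone \ot u)) ->
  (forall u, g (x \ot x \ot u) = h (x \ot x \ot u)) -> g =1 h.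
Proof.
move=> gh1b ghb1 ghxx; apply: linear_tens_ext => z u.
elim/tens_ind: z => [|y z ghy ghz|b b'].
- by rewrite linear0l !linear0.
- by rewrite linearDl !linearD ghy ghz.
(* Splitting [b] first leaves the case [x \ot b'], where [b'] is split next. *)
rewrite [b]basisE linearDl !linearZl_LR linearDl !linearZl_LR.
rewrite !linearD !linearZ /= gh1b; congr (_ + c1 b *: _).
rewrite [b']basisE linearDr !linearZr_LR linearDl !linearZl_LR.
by rewrite !linearD !linearZ /= ghb1 ghxx.
Qed.

Lemma tens_sliceE (U : lmodType k) (z : U ⊗ B) :
  z = slice c0 z \ot aone + slice c1 z \ot x.
Proof.
elim/tens_ind: z => [|y z IHy IHz|u b].
- by rewrite !linear0 !linear0l addr0.
- by rewrite {1}IHy {1}IHz !linearD !linearDl addrACA.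
- by rewrite !sliceE !linearZl_LR -!linearZr_LR -linearDr -basisE.
Qed.

Lemma slice_basis (U : lmodType k) (u v : U) (z := u \ot aone + v \ot x) :
  slice c0 z = u /\ slice c1 z = v.
Proof.
rewrite /z !linearD !sliceE c0_1 c1_1 c0_x c1_x.
by rewrite !scale1r !scale0r addr0 add0r.
Qed.

Lemma tens_basis_inj (U : lmodType k) (u v u' v' : U) :
  u \ot aone + v \ot x = u' \ot aone + v' \ot x -> u = u' /\ v = v'.
Proof.
have [e0 e1] := slice_basis u v; have [e0' e1'] := slice_basis u' v'.
by move=> e; move: e0 e1; rewrite e e0' e1'.
Qed.

Variable A : unitalAlgType k.

Section Twist.
Variables (f delta : {linear A -> A}) (tau : {linear B ⊗ A -> A ⊗ B}).
Hypothesis tau1 : forall a, tau (aone \ot a) = a \ot aone.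
Hypothesis taux : forall a, tau (x \ot a) = delta a \ot aone + f a \ot x.

Local Notation idA := (idfun : {linear A -> A}).
Local Notation idB := (idfun : {linear B -> B}).
Local Notation mu := tens_mul.

(* The right-hand sides of the two multiplicativity axioms, as linear maps. *)
Let pathA : {linear B ⊗ (A ⊗ A) -> A ⊗ B} :=
    (mu A \ox idB) \o tens_assocV A A B \o (idA \ox tau) \o
      tens_assoc A B A \o (tau \ox idA) \o tens_assocV B A A.

Let pathB : {linear B ⊗ B ⊗ A -> A ⊗ B} :=
    (idA \ox mu B) \o tens_assoc A B B \o (tau \ox idB) \o
      tens_assocV B A B \o (idB \ox tau) \o tens_assoc B B A.

Let tensE := (tens_mapE, tens_assocE, tens_assocVE, tens_mulE, tau1).

Lemma twist_mulA_1 a a' : pathA (aone \ot (a \ot a')) = amul a a' \ot aone.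
Proof. by rewrite /pathA /comp /= !tensE. Qed.

Lemma twist_mulA_x a a' :
  pathA (x \ot (a \ot a')) =
  (amul (delta a) a' + amul (f a) (delta a')) \ot aone
    + amul (f a) (f a') \ot x.
Proof.
rewrite /pathA /comp /= !tensE taux linearDl linearD !tensE.
rewrite linearD !tensE taux linearDr !linearD !tensE.
by rewrite linearDl addrA.
Qed.

Lemma twist_mulB_1l b a : pathB (aone \ot b \ot a) = tau (b \ot a).
Proof.
rewrite /pathB /comp /= !tensE; elim/tens_ind: (tau _) => [|y z IHy IHz|a' b'].
- by rewrite linear0r !linear0.
- by rewrite linearDr !linearD /= IHy IHz.
- by rewrite !tensE amul1l.
Qed.

Lemma twist_mulB_1r b a : pathB (b \ot aone \ot a) = tau (b \ot a).
Proof.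
rewrite /pathB /comp /= !tensE; elim/tens_ind: (tau _) => [|y z IHy IHz|a' b'].
- by rewrite linear0l !linear0.
- by rewrite linearDl !linearD /= IHy IHz.
- by rewrite !tensE amul1r.
Qed.

(** Applying [tau] twice moves both factors [x] past [a] and leaves one term
    [f (f a) \ot amul x x]; reducing that square is what produces [alpha] and
    [beta] here. *)
Lemma twist_mulB_xx a :
  pathB (x \ot x \ot a) =
  (delta (delta a) - beta *: f (f a)) \ot aone
    + (f (delta a) + delta (f a) + alpha *: f (f a)) \ot x.
Proof.
rewrite /pathB /comp /= !tensE taux linearDr !linearD !tensE !taux !linearDl.
rewrite !linearD !tensE !amul1r !amul1l sqrxE.
rewrite linearBr !linearZr_LR -!linearZl_LR linearNl /=.
rewrite -!addrA; congr (_ + _).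
by rewrite [RHS]addrC -!addrA.
Qed.

Lemma twist_sqrx a :
  tau (amul x x \ot a) =
  (alpha *: delta a - beta *: a) \ot aone + (alpha *: f a) \ot x.
Proof.
rewrite sqrxE linearBl !linearZl_LR (linearB tau) !(linearZ_LR tau) /= tau1 taux.
by rewrite scalerDr linearDl linearNl !linearZl_LR addrAC.
Qed.

(** Multiplicativity in [A] yields the product rules for [f] and [delta], and
    multiplicativity in [B] the two quadratic relations, each by comparing the
    coordinates at 1 and [x] of one identity in [A ⊗ B]. *)
Lemma twisting_mapP :
  twisting_map tau <->
  [/\ alg_endomorphism f, left_derivation f delta,
      forall a, delta (delta a) - alpha *: delta a + beta *: a
                = beta *: f (f a) &
      forall a, f (delta a) + delta (f a) = alpha *: (f a - f (f a))].
Proof.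
split=> [[tauA tauB _ tau1B]|[[f1 fM] derf quad skew]].
  have mulx a a' : f (amul a a') = amul (f a) (f a')
      /\ delta (amul a a') = amul (delta a) a' + amul (f a) (delta a').
    have := tauA (x \ot (a \ot a')).
    rewrite -[RHS]/(pathA _) twist_mulA_x /comp /= !tensE taux.
    by case/tens_basis_inj.
  have sqrx a : alpha *: delta a - beta *: a = delta (delta a) - beta *: f (f a)
      /\ alpha *: f a = f (delta a) + delta (f a) + alpha *: f (f a).
    have := tauB (x \ot x \ot a).
    rewrite -[RHS]/(pathB _) twist_mulB_xx /comp /= !tensE twist_sqrx.
    by case/tens_basis_inj.
  split=> [|a a'|a|a].
  - split=> [|a a']; last by case: (mulx a a').
    have /tens_basis_inj[] // : delta aone \ot aone + f aone \ot x
                              = 0 \ot aone + aone \ot x.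
    by rewrite -taux tau1B linear0l add0r.
  - by case: (mulx a a').
  - have [e _] := sqrx a.
    by rewrite -addrA [X in _ + X]addrC -opprB e opprB addrC subrK.
  - have [_ e] := sqrx a.
    by rewrite scalerBr e addrK.
(* The derivation rule at 1 * 1 reads delta 1 = delta 1 + delta 1. *)
have delta1 : delta aone = 0.
  have := derf aone aone; rewrite f1 amul1l amul1r -{1}[delta _]addr0.
  by move/addrI/esym; rewrite amul1l.
split=> //.
- apply: basis_tens3r_ext => a a'.
    by rewrite -[RHS]/(pathA _) twist_mulA_1 /comp /= !tensE.
  by rewrite -[RHS]/(pathA _) twist_mulA_x /comp /= !tensE taux derf fM.
- apply: basis_tens3_ext => [b a|b a|a].
  + by rewrite -[RHS]/(pathB _) twist_mulB_1l /comp /= !tensE amul1l.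
  + by rewrite -[RHS]/(pathB _) twist_mulB_1r /comp /= !tensE amul1r.
  rewrite -[RHS]/(pathB _) twist_mulB_xx /comp /= !tensE twist_sqrx.
  rewrite skew scalerBr subrK -quad.
  by congr (_ \ot _ + _); rewrite opprD addrA subKr.
- move=> b; rewrite [b]basisE linearDl linearD !linearZl_LR !linearZ /=.
  rewrite tau1 taux delta1 f1 linear0l add0r.
  by rewrite linearDr !linearZr_LR.
Qed.

End Twist.

(** The unique linear map with prescribed restrictions [g1] to [1 \ot A] and
    [gx] to [x \ot A], which produces a twisting map from a pair. *)
Section Extension.
Variables (W : lmodType k) (g1 gx : {linear A -> W}).

Definition basis_lift_fun (b : B) (a : A) : W := c0 b *: g1 a + c1 b *: gx a.

Fact basis_lift_bilinear :
  bilinear_for ( *:%R : k -> W -> W) ( *:%R : k -> W -> W) basis_lift_fun.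
Proof.
split=> [a|b] d y z; rewrite /= /basis_lift_fun.
  by rewrite (linearP c0) (linearP c1) /= !scalerDl scalerDr !scalerA addrACA.
rewrite (linearP g1) (linearP gx) !scalerDr !scalerA addrACA ![c0 b * _]mulrC.
by rewrite ![c1 b * _]mulrC.
Qed.

HB.instance Definition _ := bilinear_isBilinear.Build k B A W *:%R *:%R
  basis_lift_fun basis_lift_bilinear.

Definition basis_lift : {linear B ⊗ A -> W} := tens_lift basis_lift_fun.

Lemma basis_lift1 a : basis_lift (aone \ot a) = g1 a.
Proof.
by rewrite tens_liftE /= /basis_lift_fun c0_1 c1_1 scale1r scale0r addr0.
Qed.

Lemma basis_liftx a : basis_lift (x \ot a) = gx a.
Proof.
by rewrite tens_liftE /= /basis_lift_fun c0_x c1_x scale1r scale0r add0r.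
Qed.

End Extension.

(** The first component is the coefficient of [x], the endomorphism; the second
    is the coefficient of 1, the derivation. *)
Definition twist_pair (tau : {linear B ⊗ A -> A ⊗ B}) :
    {linear A -> A} * {linear A -> A} :=
  (slice c1 \o tau \o @tens k B A x : {linear A -> A},
   slice c0 \o tau \o @tens k B A x : {linear A -> A}).

Lemma twist_pairE (tau : {linear B ⊗ A -> A ⊗ B}) a :
  tau (x \ot a) = (twist_pair tau).2 a \ot aone + (twist_pair tau).1 a \ot x.
Proof. exact: tens_sliceE. Qed.

(** Injectivity holds because a twisting map is known on [1 \ot A] and is
    determined on [x \ot A] by its pair; surjectivity because [basis_lift]
    turns a pair into a linear map to which [twisting_mapP] applies. *)
Lemma twist_pair_bij :
  set_bij
    [set tau | twisting_map tau]
    [set fd | let: (f, delta) := fd in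
      [/\ alg_endomorphism f,
          left_derivation f delta,
          forall a, delta (delta a) - alpha *: delta a + beta *: a
                    = beta *: f (f a) &
          forall a, f (delta a) + delta (f a) = alpha *: (f a - f (f a))]]
    twist_pair.
Proof.
split=> [tau tauT|tau tau'|[f delta] /= fdP].
- by apply/(twisting_mapP (twisting_1A tauT) (twist_pairE tau)).
- rewrite !inE => tauT tauT' eq_pair; apply/linear_ext/linear_basis_tens_ext => a.
    by rewrite (twisting_1A tauT) (twisting_1A tauT').
  by rewrite !twist_pairE eq_pair.
pose gx : {linear A -> A ⊗ B} :=
  (applyr (@tens k A B) aone \o delta) \+ (applyr (@tens k A B) x \o f).
pose g1 : {linear A -> A ⊗ B} := applyr (@tens k A B) aone.
have tau1 := basis_lift1 g1 gx; have taux := basis_liftx g1 gx.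
exists (basis_lift g1 gx); first exact/(twisting_mapP tau1 taux).
congr (_, _); apply: linear_ext => a.
  have [_ <-] := slice_basis (delta a) (f a).
  exact: (congr1 (slice c1) (taux a)).
have [<- _] := slice_basis (delta a) (f a).
exact: (congr1 (slice c0) (taux a)).
Qed.

End QuadraticBasis.

(** * The quotient of k[X] by a quadratic polynomial *)

Definition qcoef (k : fieldType) (p : {poly k}) (i : nat)
    (b : {poly %/ p}) : k :=
  (b : {poly k})`_i.

Fact qcoef_scalar (k : fieldType) (p : {poly k}) i : scalar (@qcoef k p i).
Proof. by move=> d b b'; rewrite /qcoef /= coefD coefZ. Qed.

HB.instance Definition _ (k : fieldType) (p : {poly k}) i :=
  GRing.isLinear.Build k {poly %/ p} k *%R (@qcoef k p i) (qcoef_scalar i).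

Section QuadraticQuotient.
Variables (k : fieldType) (alpha beta : k).
Local Notation p := (quad_poly alpha beta).
Local Notation B := {poly %/ p}.

Lemma size_quad_poly : size p = 3.
Proof.
rewrite /quad_poly -addrA size_polyDl size_polyXn //.
rewrite (leq_ltn_trans (size_polyD _ _)) // gtn_max size_polyN.
rewrite (leq_ltn_trans (size_scale_leq _ _)) ?size_polyX //=.
by rewrite (leq_ltn_trans (size_polyC_leq1 _)).
Qed.

Lemma qX_quadE : ('qX : B) = 'X :> {poly k}.
Proof.
rewrite /qpolyX in_qpoly_small // mk_monic_quad_poly.
by rewrite size_quad_poly size_polyX.
Qed.

Lemma quad_basisE (b : B) : b = qcoef 0 b *: aone + qcoef 1 b *: 'qX.
Proof.
apply/val_inj/polyP => i.
rewrite -[val (_ + _)]/(qcoef 0 b *: 1 + qcoef 1 b *: (('qX : B) : {poly k})).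
rewrite qX_quadE coefD !coefZ coefC coefX /qcoef.
case: i => [|[|i]] /=; rewrite ?mulr1 ?mulr0 ?addr0 ?add0r //.
apply: nth_default; apply: leq_trans (size_npoly b) _.
by rewrite mk_monic_quad_poly size_quad_poly.
Qed.

(** In k[X], X^2 = p + (alpha X - beta), and p vanishes in the quotient. *)
Lemma qX_sqr : amul 'qX 'qX = alpha *: 'qX - beta *: aone :> B.
Proof.
have Xsqr : 'X * 'X = p + (alpha *: 'X - beta *: 1).
  by rewrite /quad_poly -expr2 -alg_polyC addrACA subrK subrr addr0.
apply: etrans (esym (in_qpolyM p 'X 'X)) _.
rewrite Xsqr linearD linearB !linearZ /= in_qpoly1.
have -> : in_qpoly p p = 0.
  have := monic_mk_monic p; rewrite mk_monic_quad_poly => monic_p.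
  by apply: val_inj; rewrite /= mk_monic_quad_poly Pdiv.RingMonic.rmodpp.
by rewrite add0r.
Qed.

End QuadraticQuotient.

Theorem lemma1p1 (k : fieldType) (A : unitalAlgType k) (alpha beta : k) :
  let B := {poly %/ quad_poly alpha beta} in
  exists Phi : {linear B ⊗ A -> A ⊗ B} -> {linear A -> A} * {linear A -> A},
    set_bij
      [set tau | twisting_map tau]
      [set fd | let: (f, delta) := fd in
        [/\ alg_endomorphism f,
            left_derivation f delta,
            forall a, delta (delta a) - alpha *: delta a + beta *: a
                      = beta *: f (f a) &
            forall a, f (delta a) + delta (f a) = alpha *: (f a - f (f a))]]
      Phi
    /\ forall tau, twisting_map tau -> forall a : A,
         tau ('qX \ot a) = (Phi tau).2 a \ot 1 + (Phi tau).1 a \ot 'qX.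
Proof.
set p := quad_poly alpha beta => B.
have [c0_1 c1_1] : qcoef 0 (1 : B) = 1 /\ qcoef 1 (1 : B) = 0.
  by rewrite /qcoef /= !coefC.
have [c0_x c1_x] : qcoef 0 ('qX : B) = 0 /\ qcoef 1 ('qX : B) = 1.
  by rewrite /qcoef qX_quadE !coefX.
have basisE := @quad_basisE k alpha beta.
exists (@twist_pair k B 'qX (qcoef 0) (qcoef 1) A); split.
  exact: (twist_pair_bij basisE c0_1 c1_1 c0_x c1_x (qX_sqr alpha beta)).
by move=> tau _ a; apply: twist_pairE.
Qed.
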